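(* Let $(X,\preceq,G)$ be a complete partially ordered $G$-metric space and let $T:X\to X$ be a non-decreasing map such that $x_0\preceq Tx_0$ for some $x_0\in X$. Suppose that there exist $\psi\in\Psi$ and $\phi\in\Phi$ such that for all $x,y\in X$ with $x\preceq y$, $$\psi(G(Tx,T^2x,Ty))\le\psi(G(x,Tx,y))-\phi(G(x,Tx,y)).$$ If either $T$ is $G$-continuous or $(X,\preceq,G)$ is regular non-decreasing, then $T$ has a fixed point in $X$.
   Context: A $G$-metric on a nonempty set $X$ is a function $G:X\times X\times X\to[0,\infty)$ such that: (G1) $G(x,y,z)=0$ if $x=y=z$; (G2) $0<G(x,x,y)$ for all $x,y\in X$ with $x\ne y$; (G3) $G(x,x,y)\le G(x,y,z)$ for all $x,y,z\in X$ with $y\neq z$; (G4) $G$ is invariant under all permutations of its three arguments; (G5) $G(x,y,z)\le G(x,a,a)+G(a,y,z)$ for all $x,y,z,a\in X$. A partially ordered $G$-metric space $(X,\preceq,G)$ is a nonempty set $X$ with a partial order $\preceq$ and a $G$-metric $G$. A sequence $(x_n)$ $G$-converges to $x$ if $G(x,x_n,x_m)\to0$ as $n,m\to\infty$; it is $G$-Cauchy if $G(x_n,x_m,x_l)\to 0$ as $n,m,l\to\infty$; the space is complete if every $G$-Cauchy sequence $G$-converges to some point of $X$. $T$ is $G$-continuous if $x_n\to x$ implies $Tx_n\to Tx$ (in the sense of $G$-convergence). $T$ is non-decreasing if $x\preceq y$ implies $Tx\preceq Ty$. $(X,\preceq,G)$ is regular non-decreasing if for every $\preceq$-non-decreasing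 sequence $(x_n)$ in $X$ with $x_n\to x^*$ one has $x_n\preceq x^*$ for all $n\in\mathbb N$. $\Psi$ is the set of functions $\psi:[0,\infty)\to[0,\infty)$ that are continuous, non-decreasing and satisfy $\psi(t)=0$ iff $t=0$. $\Phi$ is the set of functions $\phi:[0,\infty)\to[0,\infty)$ that are lower semi-continuous and satisfy $\phi(t)=0$ iff $t=0$. $T^2x$ means $T(Tx)$. *)

(* Defs.v *)
From HB Require Import structures.
From mathcomp Require Import all_boot all_order all_algebra.
From mathcomp Require Import all_classical all_reals all_analysis.

Set Implicit Arguments.
Unset Strict Implicit.
Unset Printing Implicit Defensive.

Import Order.TTheory GRing.Theory Num.Theory.
Import numFieldNormedType.Exports.

Local Open Scope classical_set_scope.
Local Open Scope ring_scope.

Record is_Gmetric (R : realType) (X : Type) (G : X -> X -> X -> R) : Prop := {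
  Gmetric_ge0 : forall x y z, 0 <= G x y z;
  Gmetric_xxx : forall x y z, x = y -> y = z -> G x y z = 0;
  Gmetric_gt0 : forall x y, x <> y -> 0 < G x x y;
  Gmetric_le : forall x y z, y <> z -> G x x y <= G x y z;
  Gmetric_perm : forall x y z,
    [/\ G x y z = G x z y, G x y z = G y x z, G x y z = G y z x,
        G x y z = G z x y & G x y z = G z y x];
  Gmetric_triangle : forall x y z a, G x y z <= G x a a + G a y z
}.

Section Gconvergence.
Context {R : realType} {X : Type}.
Variable G : X -> X -> X -> R.

(* The product filters express joint limits: all indices tend to infinity
   independently. *)
Definition Gcvg (u : nat -> X) (x : X) : Prop :=
  G x (u p.1) (u p.2) @[p --> filter_prod \oo \oo] --> (0 : R).

Definition Gcauchy (u : nat -> X) : Prop :=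
  G (u p.1.1) (u p.1.2) (u p.2)
    @[p --> filter_prod (filter_prod \oo \oo) \oo] --> (0 : R).

Definition Gcomplete : Prop :=
  forall u : nat -> X, Gcauchy u -> exists x, Gcvg u x.

Definition Gcontinuous (T : X -> X) : Prop :=
  forall (u : nat -> X) (x : X), Gcvg u x -> Gcvg (T \o u) (T x).

End Gconvergence.

Definition regular_nondecreasing (R : realType) (d : Order.disp_t)
    (X : porderType d) (G : X -> X -> X -> R) : Prop :=
  forall (u : nat -> X) (x : X),
    nondecreasing_seq u -> Gcvg G u x -> forall n, (u n <= x)%O.

(* Functions from [0, +oo[ to [0, +oo[ are represented by total functions on R,
   of which only the restriction to [0, +oo[ is constrained: in the topology of
   [subspace A] the points outside A are isolated, so that (semi-)continuity
   there is vacuous, and at points of A it is relative to A. *)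
Record in_Psi (R : realType) (psi : R -> R) : Prop := {
  Psi_ge0 : forall t, 0 <= t -> 0 <= psi t;
  Psi_continuous : {within `[0, +oo[, continuous psi};
  Psi_nondecreasing : forall s t, 0 <= s -> s <= t -> psi s <= psi t;
  Psi_eq0 : forall t, 0 <= t -> (psi t = 0 <-> t = 0)
}.

Record in_Phi (R : realType) (phi : R -> R) : Prop := {
  Phi_ge0 : forall t, 0 <= t -> 0 <= phi t;
  Phi_lsc : lower_semicontinuous
    (fun t : subspace (`[0, +oo[ : set R) => (phi t)%:E);
  Phi_eq0 : forall t, 0 <= t -> (phi t = 0 <-> t = 0)
}.

(* Main.v *)
Require Import Defs.
From HB Require Import structures.
From mathcomp Require Import all_boot all_order all_algebra.
From mathcomp Require Import all_classical all_reals all_analysis.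
From mathcomp Require Import lra.

Set Implicit Arguments.
Unset Strict Implicit.
Unset Printing Implicit Defensive.

Import Order.TTheory GRing.Theory Num.Theory.
Import numFieldNormedType.Exports.

Local Open Scope classical_set_scope.
Local Open Scope ring_scope.

(* The inequality psi b <= psi a - phi a fails when a and b are both close to some
   e > 0: psi is continuous and phi lower semicontinuous at e, with phi e > 0.
   Applied to the Picard iterates x_n, this shows first that
   g_n = G(x_n, x_(n+1), x_(n+1)), which decreases, tends to 0; then, by
   induction on n, that G(x_m, x_(m+1), x_n) < e for N <= m <= n once g_N is
   small: if this bound failed at n + 1, then both G(x_m, x_(m+1), x_(n+1)) and
   G(x_(m+1), x_(m+2), x_(n+2)) would be within a few g_N of e. Hence the orbit is
   Cauchy, and its limit is fixed by continuity, or by the contraction applied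
   to x_n <= lim x. *)

(** At a point of [A], subspace neighbourhoods are traces of ordinary ones; this turns
    [Psi_continuous] and [Phi_lsc] into epsilon-delta form. *)
Lemma subspace_nbhs_dist (R : realType) (A : set R) (t : R)
    (V : set (subspace A)) : A t -> nbhs (t : subspace A) V ->
  exists2 del, 0 < del & forall s, A s -> `|t - s| < del -> V s.
Proof.
move=> At; rewrite /nbhs/= -(nbhs_subspace_in At) => /nbhs_ballP[del /= del0 H].
by exists del => // s As ts; apply: H.
Qed.

Lemma Psi_near (R : realType) (psi : R -> R) (t e : R) :
  in_Psi psi -> 0 <= t -> 0 < e ->
  exists2 del, 0 < del & forall s, 0 <= s -> `|t - s| < del ->
    `|psi t - psi s| < e.
Proof.
move=> Hpsi t0 e0; have At : [set` `[0, +oo[] t by rewrite /= in_itv/= t0.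
have /cvgrPdist_lt/(_ e e0) := @Psi_continuous _ _ Hpsi t.
move=> /(subspace_nbhs_dist At)[del del0 H].
by exists del => // s s0; apply: H; rewrite /= in_itv/= s0.
Qed.

Lemma Psi_gt0 (R : realType) (psi : R -> R) (t : R) :
  in_Psi psi -> 0 < t -> 0 < psi t.
Proof.
move=> Hpsi t0; rewrite lt_neqAle (Psi_ge0 Hpsi (ltW t0)) andbT eq_sym.
by apply/eqP => /(Psi_eq0 Hpsi (ltW t0)) t00; rewrite t00 ltxx in t0.
Qed.

Lemma Phi_gt0 (R : realType) (phi : R -> R) (t : R) :
  in_Phi phi -> 0 < t -> 0 < phi t.
Proof.
move=> Hphi t0; rewrite lt_neqAle (Phi_ge0 Hphi (ltW t0)) andbT eq_sym.
by apply/eqP => /(Phi_eq0 Hphi (ltW t0)) t00; rewrite t00 ltxx in t0.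
Qed.

Lemma Phi_near (R : realType) (phi : R -> R) (t c : R) :
  in_Phi phi -> 0 <= t -> c < phi t ->
  exists2 del, 0 < del & forall s, 0 <= s -> `|t - s| < del -> c < phi s.
Proof.
move=> Hphi t0 ct; have At : [set` `[0, +oo[] t by rewrite /= in_itv/= t0.
have [|V] := @Phi_lsc _ _ Hphi t c; first by rewrite lte_fin.
move=> /(subspace_nbhs_dist At)[del del0 H] HV.
exists del => // s s0 /H; rewrite -lte_fin => {}H; apply: HV; apply: H.
by rewrite /= in_itv/= s0.
Qed.

(** Near [e], both [psi a] and [psi b] are within [phi e / 4] of [psi e], so they differ by less
    than [phi e / 2], while [phi a] exceeds [phi e / 2]. *)
Lemma contraction_gap (R : realType) (psi phi : R -> R) (e : R) :
  in_Psi psi -> in_Phi phi -> 0 < e ->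
  exists2 del, 0 < del & forall a b, 0 <= a -> 0 <= b ->
    `|e - a| < del -> `|e - b| < del -> psi a - phi a < psi b.
Proof.
move=> Hpsi Hphi e0; have p0 := Phi_gt0 Hphi e0.
have q0 : 0 < phi e / 4 by lra.
have [d1 d10 H1] := Psi_near Hpsi (ltW e0) q0.
have q1 : phi e / 2 < phi e by lra.
have [d2 d20 H2] := Phi_near Hphi (ltW e0) q1.
exists (Num.min d1 d2); first by rewrite lt_min d10.
move=> a b a0 b0; rewrite !lt_min => /andP[ea1 ea2] /andP[eb1 eb2].
have := H1 _ a0 ea1; have := H1 _ b0 eb1; have := H2 _ a0 ea2.
rewrite !ltr_norml; lra.
Qed.

Lemma Gmetric_rot (R : realType) (X : Type) (G : X -> X -> X -> R) x y z :
  is_Gmetric G -> G x y z = G y z x.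
Proof. by move=> HG; case: (Gmetric_perm HG x y z). Qed.

Lemma Gmetric_swap (R : realType) (X : Type) (G : X -> X -> X -> R) x y z :
  is_Gmetric G -> G x y z = G y x z.
Proof. by move=> HG; case: (Gmetric_perm HG x y z). Qed.

(** The triangle inequality only replaces the first argument; rotating after each use replaces all
    three. *)
Lemma Gmetric_move (R : realType) (X : Type) (G : X -> X -> X -> R)
    x y z x' y' z' : is_Gmetric G ->
  G x y z <= G x x' x' + G y y' y' + G z z' z' + G x' y' z'.
Proof.
move=> HG.
have := Gmetric_triangle HG x y z x'.
have := Gmetric_triangle HG y z x' y'; have := Gmetric_triangle HG z x' y' z'.
rewrite -(Gmetric_rot x' y z) // (Gmetric_rot y' z x') //.
rewrite (Gmetric_rot z' x' y') //; lra.
Qed.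

Lemma Gmetric_pair_sym (R : realType) (X : Type) (G : X -> X -> X -> R) x y :
  is_Gmetric G -> G y x x <= 2 * G x y y.
Proof.
move=> HG; have := Gmetric_move y x x y y y HG.
rewrite (Gmetric_xxx HG (erefl y) (erefl y)); lra.
Qed.

(** Converse of [Gmetric_move] with the same costs; the factor 2 comes from [Gmetric_pair_sym]. *)
Lemma Gmetric_move_sym (R : realType) (X : Type) (G : X -> X -> X -> R)
    x y z x' y' z' : is_Gmetric G ->
  G x' y' z' <= 2 * (G x x' x' + G y y' y' + G z z' z') + G x y z.
Proof.
move=> HG; have := Gmetric_move x' y' z' x y z HG.
have := Gmetric_pair_sym x x' HG; have := Gmetric_pair_sym y y' HG.
have := Gmetric_pair_sym z z' HG; lra.
Qed.

(** For [w <> z] this is (G3); the extra term pays for the case [w = z], which (G3) excludes. *)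
Lemma Gmetric_collapse (R : realType) (X : Type) (G : X -> X -> X -> R) a w z :
  is_Gmetric G -> G a a z <= G a w z + 2 * G a w w.
Proof.
move=> HG; have g0 := Gmetric_ge0 HG; have [wz|] := pselect (w = z).
  rewrite -wz -(Gmetric_rot w a a) //; have := Gmetric_pair_sym a w HG.
  have := g0 a w w; lra.
move=> /nesym/(@Gmetric_le _ _ _ HG a).
have [-> _ _ _ _] := Gmetric_perm HG a z w; have := g0 a w w; lra.
Qed.

Lemma Gmetric_eq0 (R : realType) (X : Type) (G : X -> X -> X -> R) x y :
  is_Gmetric G -> (forall e, 0 < e -> G x x y < e) -> x = y.
Proof.
move=> HG small; have [//|/(Gmetric_gt0 HG)/small] := pselect (x = y).
by rewrite ltxx.
Qed.

Lemma Gcvg_near (R : realType) (X : Type) (G : X -> X -> X -> R) u x e :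
  Gcvg G u x -> 0 < e ->
  exists N, forall n m, (N <= n)%N -> (N <= m)%N -> G x (u n) (u m) < e.
Proof.
move=> /cvgr0Pnorm_lt H /H[[P Q] /= [[N1 _ HP] [N2 _ HQ]] PQ].
exists (maxn N1 N2) => n m; rewrite !geq_max => /andP[n1 n2] /andP[m1 m2].
apply: le_lt_trans (ler_norm _) _.
by apply: (PQ (n, m)); split; [apply: HP|apply: HQ].
Qed.

(** Moving the three points to [a] costs less than [e / 3] each. The centre may vary with [e], so no
    limit is presupposed. *)
Lemma Gcauchy_of_center (R : realType) (X : Type) (G : X -> X -> X -> R) u :
  is_Gmetric G ->
  (forall e, 0 < e -> exists a N, forall n, (N <= n)%N -> G (u n) a a < e) ->
  Gcauchy G u.
Proof.
move=> HG H; apply/cvgr0Pnorm_lt => e e0.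
have e30 : 0 < e / 3 by lra.
have [a [N HN]] := H _ e30.
have tail : \forall n \near \oo, (N <= n)%N by exact: nbhs_infty_ge.
exists ([set p : nat * nat | (N <= p.1)%N /\ (N <= p.2)%N],
        [set n | (N <= n)%N]) => /=.
  by split=> //; exists ([set n | (N <= n)%N], [set n | (N <= n)%N]).
move=> [[i j] k] /= [[Ni Nj] Nk].
rewrite ger0_norm ?(Gmetric_ge0 HG) //.
have := Gmetric_move (u i) (u j) (u k) a a a HG.
rewrite (Gmetric_xxx HG (erefl a) (erefl a)).
have := HN _ Ni; have := HN _ Nj; have := HN _ Nk; lra.
Qed.

Lemma decreasing_gap_cvg0 (R : realType) (psi phi : R -> R) (g : nat -> R) :
  in_Psi psi -> in_Phi phi -> (forall n, 0 <= g n) ->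
  (forall n, psi (g n.+1) <= psi (g n) - phi (g n)) ->
  forall e, 0 < e -> exists N, forall n, (N <= n)%N -> g n < e.
Proof.
move=> Hpsi Hphi g0 Hg.
(* A strict increase would force [phi (g n) = 0], hence [g n = 0] and [psi (g n.+1) <= 0] with
   [g n.+1 > 0]. *)
have gS n : g n.+1 <= g n.
  rewrite leNgt; apply/negP => lt_g.
  have := Psi_nondecreasing Hpsi (g0 n) (ltW lt_g).
  have := Hg n; have := Phi_ge0 Hphi (g0 n) => p0 p1 p2.
  have /(Phi_eq0 Hphi (g0 n)) gn0 : phi (g n) = 0 by lra.
  have psi0 : psi (g n) = 0 by apply/(Psi_eq0 Hpsi).
  have := Psi_gt0 Hpsi (le_lt_trans (g0 n) lt_g); lra.
have g_le : {homo g : n m / (n <= m)%N >-> m <= n}.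
  by apply: homo_leq => // x y z xy yz; exact: le_trans yz xy.
have lbg : has_lbound (range g) by exists 0 => _ [n _ <-].
have infg n : inf (range g) <= g n by apply: ge_inf => //; exists n.
have nem : range g !=set0 by exists (g 0%N), 0%N.
have near e : 0 < e -> exists n, g n < inf (range g) + e.
  by move=> e0; have [_ [n _ <-] ?] := inf_adherent e0 (conj nem lbg); exists n.
have inf0 : inf (range g) = 0.
  apply/eqP; rewrite eq_le lb_le_inf ?andbT //; last by move=> _ [n _ <-].
  rewrite leNgt; apply/negP => r0.
  have [del del0 Hdel] := contraction_gap Hpsi Hphi r0.
  have [n gn] := near _ del0.
  have := Hdel (g n) (g n.+1) (g0 _) (g0 _).
  have := infg n; have := infg n.+1; have := gS n => i1 i2 i3.
  rewrite !ltr_norml => /(_ ltac:(lra) ltac:(lra)); have := Hg n; lra.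
move=> e /near[N]; rewrite inf0 add0r => gN; exists N => n Nn.
exact: le_lt_trans (g_le _ _ Nn) gN.
Qed.

Lemma orbit_gap_bound (R : realType) (X : Type) (G : X -> X -> X -> R)
    (psi phi : R -> R) (u : nat -> X) :
  is_Gmetric G -> in_Psi psi -> in_Phi phi ->
  (forall m n, (m <= n)%N -> psi (G (u m.+1) (u m.+2) (u n.+1))
     <= psi (G (u m) (u m.+1) (u n)) - phi (G (u m) (u m.+1) (u n))) ->
  (forall e, 0 < e -> exists N, forall n, (N <= n)%N ->
     G (u n) (u n.+1) (u n.+1) < e) ->
  forall e, 0 < e -> exists N, forall m n, (N <= m)%N -> (m <= n)%N ->
    G (u m) (u m.+1) (u n) < e.
Proof.
move=> HG Hpsi Hphi Hu Hg e e0.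
have [del del0 Hdel] := contraction_gap Hpsi Hphi e0.
(* With [c = Num.min del e / 8], a failure at [n.+1] puts [G (u m) (u m.+1) (u n.+1)] in [[e, e +
   2c[]. Shifting all three indices then loses at most [3c] and gains at most [6c], so both values
   stay within [8c <= del] of [e]. *)
have eta0 : 0 < Num.min del e / 8 by rewrite divr_gt0 // lt_min del0.
have [N HN] := Hg _ eta0.
have eta_del : Num.min del e <= del by rewrite ge_min lexx.
have eta_e : Num.min del e <= e by rewrite ge_min lexx orbT.
move: (Num.min del e) => eta in eta0 HN eta_del eta_e *.
exists N => m n Nm; elim: n => [|n IH].
  (* The induction really starts at [n = m], which occurs here as [m = 0] and below as [m = n.+1];
     there the bound is [2c < e]. *)
  rewrite leqn0 => /eqP m0; have := HN _ Nm.
  have := Gmetric_pair_sym (u m) (u m.+1) HG.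
  have -> : G (u m) (u m.+1) (u 0%N) = G (u m.+1) (u m) (u m).
    by rewrite m0 (Gmetric_rot _ _ (u 0%N)).
  lra.
rewrite leq_eqVlt => /predU1P[mn|]; last rewrite ltnS => mn.
  rewrite -mn (Gmetric_rot (u m)) //; have := HN _ Nm.
  have := Gmetric_pair_sym (u m) (u m.+1) HG; lra.
have g0 := Gmetric_ge0 HG; have Nn := leq_trans Nm mn.
have gn := HN _ Nn; have gn1 := HN _ (leqW Nn).
have gm := HN _ Nm; have gm1 := HN _ (leqW Nm).
have Gxxx x : G x x x = 0 by exact: (Gmetric_xxx HG).
rewrite ltNge; apply/negP => le_e; have := IH mn => {}IH.
have up := Gmetric_move_sym (u m) (u m.+1) (u n) (u m) (u m.+1) (u n.+1) HG.
rewrite !Gxxx in up.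
have ab := Gmetric_move (u m) (u m.+1) (u n.+1) (u m.+1) (u m.+2) (u n.+2) HG.
have ba :=
  Gmetric_move_sym (u m) (u m.+1) (u n.+1) (u m.+1) (u m.+2) (u n.+2) HG.
have := Hu m n.+1 (leqW mn).
have := Hdel _ _ (g0 (u m) (u m.+1) (u n.+1)) (g0 (u m.+1) (u m.+2) (u n.+2)).
rewrite !ltr_norml => /(_ ltac:(lra) ltac:(lra)); lra.
Qed.

Theorem theorem2p7 (R : realType) (d : Order.disp_t) (X : porderType d)
    (G : X -> X -> X -> R) (T : X -> X)
    (X_nonempty : [set: X] !=set0)
    (G_metric : is_Gmetric G)
    (G_complete : Gcomplete G)
    (T_nondecreasing : forall x y : X, (x <= y)%O -> (T x <= T y)%O)
    (x0_le_Tx0 : exists x0 : X, (x0 <= T x0)%O)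
    (T_contraction : exists psi phi : R -> R,
      [/\ in_Psi psi, in_Phi phi &
        forall x y : X, (x <= y)%O ->
          psi (G (T x) (T (T x)) (T y))
            <= psi (G x (T x) y) - phi (G x (T x) y)])
    (T_continuous_or_regular : Gcontinuous G T \/ regular_nondecreasing G) :
  exists x : X, T x = x.
Proof.
have [x0 x0le] := x0_le_Tx0; have [psi [phi [Hpsi Hphi Hc]]] := T_contraction.
have g0 := Gmetric_ge0 G_metric.
pose u n := iter n T x0.
have u_nd : nondecreasing_seq u.
  by apply/nondecreasing_seqP; elim=> [|n IH] //=; exact: T_nondecreasing.
have Hu m n : (m <= n)%N -> psi (G (u m.+1) (u m.+2) (u n.+1))
     <= psi (G (u m) (u m.+1) (u n)) - phi (G (u m) (u m.+1) (u n)).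
  by move=> mn; apply: Hc; exact: u_nd.
have Hg := decreasing_gap_cvg0 Hpsi Hphi
  (fun n => g0 (u n) (u n.+1) (u n.+1)) (fun n => Hu n n.+1 (leqnSn n)).
have cauchy_u : Gcauchy G u.
  apply: Gcauchy_of_center => // e e0; have e20 : 0 < e / 2 by lra.
  have e40 : 0 < e / 4 by lra.
  have [N1 H1] := orbit_gap_bound G_metric Hpsi Hphi Hu Hg e20.
  have [N2 H2] := Hg _ e40.
  (* The centre is [u N] itself; [Gmetric_collapse] gives [e / 2 + 2 * (e / 4)]. *)
  pose N := maxn N1 N2; exists (u N), N => n Nn.
  rewrite (Gmetric_rot (u n)) //; have := H1 N n (leq_maxl _ _) Nn.
  have := H2 N (leq_maxr _ _).
  have := Gmetric_collapse (u N) (u N.+1) (u n) G_metric; lra.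
have [x ux] := G_complete _ cauchy_u; exists x; apply: esym.
apply: (Gmetric_eq0 G_metric) => e e0; have e40 : 0 < e / 4 by lra.
have [N1 H1] := Gcvg_near ux e40.
have to_orbit n : G x x (T x) <= 2 * G x (u n) (u n) + G (T x) (u n) (u n).
  have := Gmetric_move x x (T x) (u n) (u n) (u n) G_metric.
  rewrite (Gmetric_xxx G_metric (erefl (u n)) (erefl (u n))); lra.
case: T_continuous_or_regular => [/(_ _ _ ux) Tux|reg].
  have [N2 H2] := Gcvg_near Tux e40; pose N := maxn N1 N2.
  (* The term of [T \o u] at [N] is [u N.+1], hence the shifted index. *)
  have N1N : (N1 <= N.+1)%N by rewrite leqW // leq_maxl.
  have := H2 N N (leq_maxr _ _) (leq_maxr _ _).
  have := H1 _ _ N1N N1N; have := to_orbit N.+1; rewrite /=; lra.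
(* The tolerance [psi (e / 4)] lets monotonicity turn a bound on [psi] of the image triple into a
   bound [e / 4] on the triple itself. *)
have [del del0 Hdel] := Psi_near Hpsi (lexx 0) (Psi_gt0 Hpsi e40).
have [N2 H2] := Gcvg_near ux del0; have e160 : 0 < e / 16 by lra.
have [N3 H3] := Hg _ e160; pose N := maxn N1 (maxn N2 N3).
have [N1N N2N N3N] : [/\ (N1 <= N)%N, (N2 <= N)%N & (N3 <= N)%N].
  by rewrite /N !leq_max !leqnn !orbT.
have := Hc _ _ (reg _ _ u_nd ux N).
rewrite -/(u N.+1) -/(u N.+2).
have := Phi_ge0 Hphi (g0 (u N) (u N.+1) x).
have := Hdel _ (g0 (u N) (u N.+1) x).
rewrite -(Gmetric_rot x) // sub0r normrN (ger0_norm (g0 _ _ _)).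
move=> /(_ (H2 _ _ N2N (leqW N2N))); rewrite ltr_norml.
have -> : psi 0 = 0 by apply/(Psi_eq0 Hpsi).
move=> psi1 phi0 psi2.
have small : G (u N.+1) (u N.+2) (T x) < e / 4.
  rewrite ltNge; apply/negP => /(Psi_nondecreasing Hpsi (ltW e40)); lra.
(* The total is [2 * (e / 4) + e / 4 + 2 * (e / 16)], which is less than [e]. *)
have := Gmetric_collapse (u N.+1) (u N.+2) (T x) G_metric.
rewrite -(Gmetric_rot (T x)) //.
have := H3 _ (leqW N3N); have := H1 _ _ (leqW N1N) (leqW N1N).
have := to_orbit N.+1; lra.
Qed.
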